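(* The map $\mathbb B\to\mathbb V(\overline K)$, sending $B^\bullet\in\mathbb B_{\mathrm{qcut}}$ to (the class of) $\omega_{B^\bullet}$ and $[\mathcal B]\in\mathbb B_\infty$ to $\omega_{\mathcal B}$, is an isomorphism of posets.
   Context: $(K,v)$ valued field, $\overline K$ algebraic closure, $\bar v$ fixed extension of $v$ to $\overline K$, value group $\Gamma$. Quasi-cuts $\delta=(\delta^L,\delta^R)$: $\delta^L\le\delta^R$, $\delta^L\cup\delta^R=\Gamma$; $\operatorname{Qcuts}(\Gamma)=\Gamma\sqcup\operatorname{Cuts}(\Gamma)$ ($\gamma\leftrightarrow(\Gamma_{\le\gamma},\Gamma_{\ge\gamma})$; cuts have $\delta^L<\delta^R$), totally ordered by $\delta\le\epsilon\iff\delta^L\subseteq\epsilon^L,\ \delta^R\supseteq\epsilon^R$. Balls $B(a,\gamma)=\{c:\bar v(c-a)\ge\gamma\}$ ($\gamma\in\Gamma$), $B(a,\delta)=\{c:\bar v(c-a)>\delta^L\}$ ($\delta$ a cut). Pointed balls $B^\bullet(a,\delta)=(B(a,\delta),\delta)$ form $\mathbb B_{\mathrm{qcut}}$, ordered by $B^\bullet(a,\delta)\le B^\bullet(b,\epsilon)\iff B(a,\delta)\supseteq B(b,\epsilon)$ and $\delta\le\epsilon$. $x_\delta=\delta$ if $\delta\in\Gamma$; for a cut, $x_\delta$ is a formal element of $\Gamma(\delta)=x_\delta\mathbb Z\oplus\Gamma$ ordered with $\delta^L<x_\delta<\delta^R$; $\omega_{B^\bullet(a,\delta)}=\omega_{a,\delta}$,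 $\omega_{a,\delta}(\sum a_n(x-a)^n)=\min_n\{\bar v(a_n)+nx_\delta\}$. $\mathbb B_\infty$ is the set of classes, under mutual cofinality, of nests $\mathcal B=(B_i)_{i\in I}$ of closed balls with radii in $\Gamma$ (strictly decreasing in $i$) with $\bigcap B_i=\emptyset$, and $\omega_{\mathcal B}(f)=\max_i\omega_{B_i}(f)$. $\mathbb B=\mathbb B_\infty\sqcup\mathbb B_{\mathrm{qcut}}$ is ordered by the order of $\mathbb B_{\mathrm{qcut}}$, elements of $\mathbb B_\infty$ being pairwise incomparable, and $B^\bullet\le[\mathcal B]\iff\operatorname{under}(B^\bullet)\supseteq B_i$ for some $i$, where $\operatorname{under}(B(a,\delta),\delta)=B(a,\delta)$. $\mathbb V(\overline K)$ is the set of equivalence classes of valuations on $\overline K(x)$ extending $\bar v$ (up to equivalence), with partial order: $\mu\le\nu$ iff $\mu(f)\le\nu(f)$ for all $f\in\overline K[x]$, understood for inequivalent $\mu,\nu$ as: for each $f$ there is $\gamma\in\Gamma$ with $\mu(f)\le\gamma\le\nu(f)$. *)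

(* Defs.v *)
From mathcomp Require Import all_boot all_order all_algebra fraction.
Set Implicit Arguments. Unset Strict Implicit. Unset Printing Implicit Defensive.
Import Order.TTheory GRing.Theory.
Local Open Scope ring_scope.
Notation "x %:F" := (@FracField.tofrac _ x) : ring_scope.

Record oZmodType := OZmod {
  oz_sort :> zmodType;
  oz_le : rel oz_sort;
  oz_refl : reflexive oz_le;
  oz_trans : transitive oz_le;
  oz_anti : antisymmetric oz_le;
  oz_total : total oz_le;
  oz_lerD2r : forall x y z : oz_sort, oz_le x y -> oz_le (x + z) (y + z)
}.
Arguments oz_le {o}.

Notation "x <=z y" := (oz_le x y) (at level 70, no associativity).
Definition oz_lt {T : oZmodType} (x y : T) : bool := (x != y) && (x <=z y).
Notation "x <z y" := (oz_lt x y) (at level 70, no associativity).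
Definition oz_min {T : oZmodType} (x y : T) : T := if x <=z y then x else y.

(* Values: [option T], with [None] playing the role of infinity (top). *)
Section Values.
Context {T : oZmodType}.

Definition leO (u v : option T) : bool :=
  match u, v with
  | _, None => true
  | None, Some _ => false
  | Some x, Some y => x <=z y
  end.

Definition ltO (u v : option T) : bool :=
  match u, v with
  | None, _ => false
  | Some _, None => true
  | Some x, Some y => x <z y
  end.

Definition minO (u v : option T) : option T :=
  match u, v with
  | None, _ => v
  | _, None => u
  | Some x, Some y => Some (oz_min x y)
  end.

Definition addO (u v : option T) : option T :=
  match u, v with
  | Some x, Some y => Some (x + y)
  | _, _ => None
  end.

Definition is_val (R : nzRingType) (mu : R -> option T) : Prop :=
  [/\ forall x, mu x = None <-> x = 0,
      forall x y, mu (x * y) = addO (mu x) (mu y) &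
      forall x y, leO (minO (mu x) (mu y)) (mu (x + y))].
End Values.

Section Balls.
Context {L : closedFieldType} {G : oZmodType}.
Variable vbar : L -> option G.

(* A quasi-cut delta = (delta^L, delta^R): delta^L <= delta^R and
   delta^L u delta^R = G.  (Improper cuts are included.) *)
Record qcut := QCut {
  qL : G -> Prop;
  qR : G -> Prop;
  qcut_le_LR : forall l r, qL l -> qR r -> l <=z r;
  qcut_cover : forall g, qL g \/ qR g
}.

Definition qcut_eq (dl ep : qcut) : Prop :=
  (forall g, qL dl g <-> qL ep g) /\ (forall g, qR dl g <-> qR ep g).

Definition qcut_le (dl ep : qcut) : Prop :=
  (forall g, qL dl g -> qL ep g) /\ (forall g, qR ep g -> qR dl g).

(* delta is (the quasi-cut of) an element of G iff delta^L n delta^R <> 0;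
   otherwise it is a cut. *)
Definition is_cut (dl : qcut) : Prop := forall g, ~ (qL dl g /\ qR dl g).

Definition cball (a : L) (g : G) (c : L) : Prop := leO (Some g) (vbar (c - a)).

(* B(a, delta): if delta = g in G, the closed ball B(a,g);
   if delta is a cut, {c | vbar(c - a) > delta^L}. *)
Definition ball (a : L) (dl : qcut) (c : L) : Prop :=
  (forall g, qL dl g -> qR dl g -> leO (Some g) (vbar (c - a))) /\
  (is_cut dl -> forall l, qL dl l -> ltO (Some l) (vbar (c - a))).

(* A nest of closed balls with radii in G: the family of balls B(a,g),
   (a,g) in [nmem], indexed by itself, totally ordered by inclusion
   (strictly decreasing), with empty intersection. *)
Record nest := Nest {
  nmem : L -> G -> Prop;
  nest_chain : forall a g b e, nmem a g -> nmem b e ->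
     (forall c, cball a g c -> cball b e c) \/ (forall c, cball b e c -> cball a g c);
  nest_empty : forall c, exists a g, nmem a g /\ ~ cball a g c
}.

Definition cofinal (N M : nest) : Prop :=
  forall a g, nmem N a g -> exists b e, nmem M b e /\ (forall c, cball b e c -> cball a g c).
Definition nest_equiv (N M : nest) : Prop := cofinal N M /\ cofinal M N.

(* Representatives of elements of B = B_oo u B_qcut:
   BQ a delta stands for the pointed ball B^.(a,delta) = (B(a,delta), delta),
   BN N for the class [N] in B_oo. *)
Inductive Bel := BQ of L & qcut | BN of nest.

Definition Beq (b b' : Bel) : Prop :=
  match b, b' with
  | BQ a dl, BQ a' dl' => (forall c, ball a dl c <-> ball a' dl' c) /\ qcut_eq dl dl'
  | BN N, BN N' => nest_equiv N N'
  | _, _ => False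
  end.

Definition Ble (b b' : Bel) : Prop :=
  match b, b' with
  | BQ a dl, BQ a' dl' => (forall c, ball a' dl' c -> ball a dl c) /\ qcut_le dl dl'
  | BQ a dl, BN N => exists b e, nmem N b e /\ (forall c, cball b e c -> ball a dl c)
  | BN N, BN N' => nest_equiv N N'
  | BN _, BQ _ _ => False
  end.
End Balls.
Arguments BQ {L G vbar} _ _.
Arguments BN {L G vbar} _.

Section Vals.
Context {L : closedFieldType} {G : oZmodType}.
Variable vbar : L -> option G.

Notation KX := {fraction {poly L}}.

(* A candidate valuation on L(x): a totally ordered abelian group Lam, a map
   G -> Lam (identifying G with a subgroup of Lam), and the map L(x) -> Lam u {oo}. *)
Record vpkg := VPkg {
  vgrp : oZmodType;
  vemb : G -> vgrp;
  vmap : KX -> option vgrp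
}.

Definition inV (P : vpkg) : Prop :=
  [/\ is_val (vmap P),
      (forall g h, vemb P (g + h) = vemb P g + vemb P h),
      (forall g h, (vemb P g <=z vemb P h) = (g <=z h)) &
      (forall c : L, vmap P ((c%:P)%:F) = omap (vemb P) (vbar c))].

Definition Veq (P Q : vpkg) : Prop :=
  forall h : KX, leO (Some 0) (vmap P h) = leO (Some 0) (vmap Q h).

Definition Vle (P Q : vpkg) : Prop :=
  Veq P Q \/
  (forall f : {poly L}, f != 0 -> exists g : G,
     leO (vmap P (f%:F)) (Some (vemb P g)) /\ leO (Some (vemb Q g)) (vmap Q (f%:F))).

(* omega_{a,x}(f) = min_n { emb(vbar(a_n)) + n x } where f = sum a_n (X - a)^n *)
Definition omega_gen {Lam : oZmodType} (emb : G -> Lam) (x : Lam) (a : L)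
    (f : {poly L}) : option Lam :=
  \big[minO/None]_(n < size f)
     omap (fun g => emb g + x *+ n) (vbar ((f \Po ('X + a%:P))`_n)).

(* x realizes the quasi-cut delta in Lam: x = delta if delta in G,
   delta^L < x < delta^R with x a new (formal) element if delta is a cut *)
Definition realizes {Lam : oZmodType} (emb : G -> Lam) (dl : qcut) (x : Lam) : Prop :=
  [/\ forall l, qL dl l -> emb l <=z x,
      forall r, qR dl r -> x <=z emb r &
      is_cut dl -> forall g, x <> emb g].

Definition is_omega_qcut (a : L) (dl : qcut) (P : vpkg) : Prop :=
  exists x : vgrp P, realizes (vemb P) dl x /\
    forall f : {poly L}, vmap P (f%:F) = omega_gen (vemb P) x a f.

Definition is_omega_nest (N : nest vbar) (P : vpkg) : Prop :=
  forall f : {poly L}, f != 0 -> exists g : G,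
    [/\ vmap P (f%:F) = Some (vemb P g),
        exists a e, nmem N a e /\ omega_gen id e a f = Some g &
        forall a e, nmem N a e -> leO (omega_gen id e a f) (Some g)].
End Vals.

(* Main.v *)
(** Over the algebraically closed field [L] an extension of [vbar] to [L(x)] is
    determined by its values on the linear polynomials [x - c].  For
    [omega_(a, delta)] these are [min (x_delta, vbar (a - c))]; for a nest [N] the
    value at [x - c] is [vbar (a - c)] for the centre [a] of any ball of [N] that
    avoids [c].  Comparisons between valuations on the one side and between balls
    on the other therefore both reduce to linear polynomials and the ultrametric
    inequality.  An arbitrary extension [P] is of the first kind, centred at [c],
    when [P (x - c)] is the maximum of the values [P (x - b)], and of the second
    kind when there is no maximum: the balls [B(c, P (x - c))] then form a nest. *)

(* Two extensions take values in different ordered groups, so [G] is the only common yardstick.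
   Equivalence compares signs of values, and values have the form [g + m x]; everything rests on the
   fact that the sign of [g + m x] depends only on the quasi-cut of [x] in [G]. Divisibility of [G]
   gives this: with [m t = - g] the expression is [m (x - t)], and the quasi-cut tells on which side
   of [x] the element [t] lies. The same remark makes the order on the group generated by [G] and a
   formal [x] total. An inequality must be certified by elements of [G] between the two values.
   Distinct comparable quasi-cuts leave room for such an element, equal ones need not, and then the
   balls coincide and the first alternative of [Vle] applies. Elements of the poset and of the
   target are both given by representatives. Hence the comparison results are proved for every
   package that meets the specification of a representative, and the map itself is obtained by
   choice. *)
Require Import Defs.
From mathcomp Require Import all_boot all_order all_algebra fraction.
From mathcomp Require Import boolp zify.
Set Implicit Arguments. Unset Strict Implicit. Unset Printing Implicit Defensive.
Import GRing.Theory.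
Local Open Scope ring_scope.

(** * Totally ordered abelian groups and their extension by infinity *)

Section OrderedGroup.
Variable T : oZmodType.
Implicit Types (x y z : T) (u v w t : option T).

Lemma oz_leD2r z x y : (x + z <=z y + z) = (x <=z y).
Proof.
apply/idP/idP => [h|]; last exact: oz_lerD2r.
by have := oz_lerD2r (- z) h; rewrite !addrK.
Qed.

Lemma oz_leD2l z x y : (z + x <=z z + y) = (x <=z y).
Proof. by rewrite ![z + _]addrC oz_leD2r. Qed.

Lemma oz_leD x y x' y' : x <=z y -> x' <=z y' -> x + x' <=z y + y'.
Proof. by move=> h h'; apply: (oz_trans (y := y + x')); rewrite ?oz_leD2r ?oz_leD2l. Qed.

Lemma oz_le_eq x y : x <=z y -> y <=z x -> x = y.
Proof. by move=> h h'; apply: (@oz_anti T); rewrite h. Qed.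

Lemma oz_nle x y : ~~ (x <=z y) -> y <=z x.
Proof. by case/orP: (oz_total x y) => ->. Qed.

Lemma oz_ltNge x y : (x <z y) = ~~ (y <=z x).
Proof.
rewrite /oz_lt; apply/andP/idP => [[nxy xy]|nyx]; last first.
  split; last exact: oz_nle.
  by apply: contraNneq nyx => ->; exact: oz_refl.
by apply: contra nxy => yx; apply/eqP/oz_le_eq.
Qed.

Lemma oz_subr_ge0 x y : (0 <=z y - x) = (x <=z y).
Proof. by rewrite -(oz_leD2r x) add0r subrK. Qed.

Lemma oz_leN x y : (- x <=z - y) = (y <=z x).
Proof. by rewrite -oz_subr_ge0 opprK addrC oz_subr_ge0. Qed.

Lemma oz_mulrn_ge0 n x : (0 <=z x *+ n.+1) = (0 <=z x).
Proof.
apply/idP/idP => [h|h].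
  apply: contraLR h => h; elim: n => [|n IH]; first by rewrite mulr1n.
  apply: contra IH => h'; apply: (oz_trans h').
  by rewrite mulrS -[X in _ <=z X]add0r oz_leD2r oz_nle.
elim: n => [|n IH]; first by rewrite mulr1n.
by rewrite mulrS -[0]addr0; exact: oz_leD.
Qed.

Lemma oz_lerMn2 n x y : x <=z y -> x *+ n <=z y *+ n.
Proof.
case: n => [|n] h; first by rewrite !mulr0n oz_refl.
by rewrite -oz_subr_ge0 -mulrnBl oz_mulrn_ge0 oz_subr_ge0.
Qed.

Lemma leO_refl u : leO u u.
Proof. by case: u => //= x; exact: oz_refl. Qed.

Lemma leO_trans v u w : leO u v -> leO v w -> leO u w.
Proof. by move: u v w => [x|] [y|] [z|] //=; exact: oz_trans. Qed.

Lemma leO_total u v : leO u v || leO v u.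
Proof. by move: u v => [x|] [y|] //=; exact: oz_total. Qed.

Lemma leO_eq u v : leO u v -> leO v u -> u = v.
Proof. by move: u v => [x|] [y|] //= h h'; rewrite (oz_le_eq h h'). Qed.

Lemma leO_None u : leO u None.
Proof. by case: u. Qed.

Lemma ltONge u v : ltO u v = ~~ leO v u.
Proof. by move: u v => [x|] [y|] //=; rewrite oz_ltNge. Qed.

Lemma ltOW u v : ltO u v -> leO u v.
Proof. by rewrite ltONge; case/orP: (leO_total u v) => [->|->]. Qed.

Lemma ltO_le_trans v u w : ltO u v -> leO v w -> ltO u w.
Proof. by rewrite !ltONge => uv vw; apply: contra uv; exact: leO_trans. Qed.

Lemma leO_min t u v : leO t (minO u v) = leO t u && leO t v.
Proof.
move: u v => [x|] [y|] /=; rewrite ?leO_None ?andbT //.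
case: t => [z|//=] /=; rewrite /oz_min; case: ifP => [xy|/negbT/oz_nle xy].
  by case zx: (z <=z x) => //=; rewrite (oz_trans zx xy).
by case zy: (z <=z y); rewrite ?andbF ?andbT // (oz_trans zy xy).
Qed.

Lemma minO_le t u v : leO (minO u v) t = leO u t || leO v t.
Proof.
apply/idP/idP => [|]; last first.
  have := leO_refl (minO u v); rewrite leO_min => /andP[h1 h2].
  by case/orP => [/(leO_trans h1)|/(leO_trans h2)].
move: u v => [x|] [y|] /=; try by move=> ->; rewrite ?orbT.
by case: t => //= z; rewrite /oz_min; case: ifP => _ ->; rewrite ?orbT.
Qed.

Lemma ltO_min t u v : ltO t (minO u v) = ltO t u && ltO t v.
Proof. by rewrite !ltONge minO_le negb_or. Qed.

Lemma minO_l u v : leO u v -> minO u v = u.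
Proof. by move=> h; apply: leO_eq; rewrite ?minO_le ?leO_min leO_refl ?h. Qed.

Lemma minO_r u v : leO v u -> minO u v = v.
Proof. by move=> h; apply: leO_eq; rewrite ?minO_le ?leO_min leO_refl ?h ?orbT. Qed.

Lemma addOC : commutative (@addO T).
Proof. by move=> [x|] [y|] //=; rewrite addrC. Qed.

Lemma addOA : associative (@addO T).
Proof. by move=> [x|] [y|] [z|] //=; rewrite addrA. Qed.

Lemma addO0 u : addO u (Some 0) = u.
Proof. by case: u => //= x; rewrite addr0. Qed.

Lemma addOACA u v w t : addO (addO u v) (addO w t) = addO (addO u w) (addO v t).
Proof. by rewrite -!addOA; congr addO; rewrite !addOA (addOC v). Qed.

Lemma leO_add u v w t : leO u v -> leO w t -> leO (addO u w) (addO v t).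
Proof. by move: u v w t => [x|] [y|] [z|] [s|] //=; exact: oz_leD. Qed.

Lemma leO_add2r z u v : leO (addO u (Some z)) (addO v (Some z)) = leO u v.
Proof. by move: u v => [x|] [y|] //=; exact: oz_leD2r. Qed.

Lemma ltO_add2r z u v : ltO (addO u (Some z)) (addO v (Some z)) = ltO u v.
Proof. by rewrite !ltONge leO_add2r. Qed.

Lemma leO_ltO_add u v w t : w <> None ->
  ltO u v -> leO w t -> ltO (addO u w) (addO v t).
Proof.
case: w => // z _ uv zt; apply: (ltO_le_trans (v := addO v (Some z))).
  by rewrite ltO_add2r.
by apply: leO_add => //; exact: leO_refl.
Qed.

Lemma leO_subl z u v : leO (addO u (Some (- z))) v = leO u (addO v (Some z)).
Proof. by rewrite -(leO_add2r z) -addOA /= addNr addO0. Qed.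

Lemma ltO_subl z u v : ltO (addO u (Some (- z))) v = ltO u (addO v (Some z)).
Proof. by rewrite -(ltO_add2r z) -addOA /= addNr addO0. Qed.

Lemma big_minO_ge n (F : 'I_n -> option T) t :
  (forall i, leO t (F i)) <-> leO t (\big[minO/None]_(i < n) F i).
Proof.
elim: n F => [|n IH] F; first by rewrite big_ord0 leO_None; split=> // _ [].
rewrite big_ord_recl leO_min; split=> [h|/andP[h0 /IH h] i].
  by rewrite h; apply/IH => i; exact: h.
by case: (unliftP ord0 i) => [j|] ->.
Qed.

Lemma big_minO_attained n (F : 'I_n -> option T) :
  \big[minO/None]_(i < n) F i = None \/ exists i, \big[minO/None]_(i < n) F i = F i.
Proof.
elim: n F => [|n IH] F; first by rewrite big_ord0; left.
rewrite big_ord_recl; case/orP: (leO_total (F ord0) (\big[minO/None]_(i < n) F (lift ord0 i))).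
  by move/minO_l->; right; exists ord0.
move/minO_r->; case: (IH (fun i => F (lift ord0 i))) => [->|[i ->]]; first by left.
by right; exists (lift ord0 i).
Qed.

End OrderedGroup.

(** * Valuations *)

Section Valuation.
Variables (T : oZmodType) (R : nzRingType) (mu : R -> option T).
Hypothesis mu_val : is_val mu.
Implicit Types (x y z : R) (t : option T).

Lemma val_zero : mu 0 = None.
Proof. by case: mu_val => h _ _; apply/h. Qed.

Lemma val_mul x y : mu (x * y) = addO (mu x) (mu y).
Proof. by case: mu_val. Qed.

Lemma val_neq0 x : x != 0 -> exists g, mu x = Some g.
Proof.
move=> /eqP nx; case: mu_val => h _ _.
by case e: (mu x) => [g|]; [exists g | case: nx; apply/h].
Qed.

Lemma val_Some x g : mu x = Some g -> x != 0.
Proof. by move=> e; apply/eqP => x0; rewrite x0 val_zero in e. Qed.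

Lemma val_one : mu 1 = Some 0.
Proof.
have [g e] := val_neq0 (oner_neq0 R); have := val_mul 1 1.
by rewrite mulr1 e => -[/(congr1 (fun u : T => u - g))]; rewrite addrK subrr => <-.
Qed.

(** Squaring gives [g + g = 0] for the value [g], and an ordered group has no torsion. *)
Lemma val_opp1 : mu (-1) = Some 0.
Proof.
have n1 : (-1 : R) != 0 by rewrite oppr_eq0 oner_neq0.
have [g e] := val_neq0 n1; have := val_mul (-1) (-1).
rewrite mulrNN mulr1 val_one e => -[h]; congr Some.
by case/orP: (oz_total g 0) => g0; apply: oz_le_eq => //; rewrite -(oz_leD2l g) -h addr0.
Qed.

Lemma val_opp x : mu (- x) = mu x.
Proof. by rewrite -mulN1r val_mul val_opp1 addOC addO0. Qed.

Lemma val_exp x g n : mu x = Some g -> mu (x ^+ n) = Some (g *+ n).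
Proof.
move=> e; elim: n => [|n IH]; first by rewrite expr0 val_one.
by rewrite exprS val_mul IH e /= mulrS.
Qed.

Lemma valBC x y : mu (x - y) = mu (y - x).
Proof. by rewrite -val_opp opprB. Qed.

Lemma valD_ge t x y : leO t (mu x) -> leO t (mu y) -> leO t (mu (x + y)).
Proof.
by move=> hx hy; case: mu_val => _ _ h; apply: leO_trans (h x y); rewrite leO_min hx.
Qed.

Lemma valD_gt t x y : ltO t (mu x) -> ltO t (mu y) -> ltO t (mu (x + y)).
Proof.
by move=> hx hy; case: mu_val => _ _ h; apply: ltO_le_trans (h x y); rewrite ltO_min hx.
Qed.

Lemma val_sum_ge (I : Type) (r : seq I) (P : pred I) (F : I -> R) t :
  (forall i, P i -> leO t (mu (F i))) -> leO t (mu (\sum_(i <- r | P i) F i)).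
Proof. by move=> h; elim/big_ind: _ => //; [rewrite val_zero leO_None|exact: valD_ge]. Qed.

Lemma val_sum_gt (I : Type) (r : seq I) (P : pred I) (F : I -> R) g :
  (forall i, P i -> ltO (Some g) (mu (F i))) ->
  ltO (Some g) (mu (\sum_(i <- r | P i) F i)).
Proof. by move=> h; elim/big_ind: _ => //; [rewrite val_zero|exact: valD_gt]. Qed.

Lemma valD_lt x y : ltO (mu x) (mu y) -> mu (x + y) = mu x.
Proof.
move=> xy; apply: leO_eq; last by apply: valD_ge (ltOW xy); exact: leO_refl.
apply: contraTT (leO_refl (mu x)); rewrite -!ltONge => h.
by rewrite -{2}(addrK y x); apply: valD_gt => //; rewrite val_opp.
Qed.

Lemma val_ultra t y x z :
  leO t (mu (x - y)) -> leO t (mu (y - z)) -> leO t (mu (x - z)).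
Proof. by move=> h h'; rewrite -[x - z](subrKA y); exact: valD_ge. Qed.

Lemma val_isosceles x y z :
  ltO (mu (x - y)) (mu (y - z)) -> mu (x - z) = mu (x - y).
Proof. by move=> h; rewrite -[x - z](subrKA y); exact: valD_lt. Qed.

End Valuation.

Section FieldValuation.
Variables (T : oZmodType) (F : fieldType) (mu : F -> option T).
Hypothesis mu_val : is_val mu.

Lemma val_inv x g : mu x = Some g -> mu x^-1 = Some (- g).
Proof.
move=> e; have nx := val_Some mu_val e; have := val_mul mu_val x x^-1.
rewrite divff // (val_one mu_val) e; case: (mu _) => //= h [/esym e'].
by congr Some; apply/eqP; rewrite -addr_eq0 addrC e'.
Qed.

End FieldValuation.

Section ConstantExtension.
Variables (G T : oZmodType) (emb : G -> T).
Hypothesis embD : forall g h, emb (g + h) = emb g + emb h.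
Hypothesis emb_le : forall g h, (emb g <=z emb h) = (g <=z h).

Lemma emb_inj : injective emb.
Proof. by move=> g h e; apply: oz_le_eq; rewrite -emb_le e oz_refl. Qed.

Lemma emb0 : emb 0 = 0.
Proof. by apply: (addIr (emb 0)); rewrite -embD !add0r. Qed.

Lemma embN g : emb (- g) = - emb g.
Proof. by apply/eqP; rewrite -addr_eq0 -embD addNr emb0. Qed.

Lemma embMn g n : emb (g *+ n) = emb g *+ n.
Proof. by elim: n => [|n IH]; rewrite ?emb0 // !mulrS embD IH. Qed.

Lemma embMz g (m : int) : emb (g *~ m) = emb g *~ m.
Proof. by case: m => n; rewrite /intmul ?embN embMn. Qed.

Lemma leO_emb u v : leO (omap emb u) (omap emb v) = leO u v.
Proof. by move: u v => [g|] [h|] //=; exact: emb_le. Qed.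

Lemma ltO_emb u v : ltO (omap emb u) (omap emb v) = ltO u v.
Proof. by rewrite !ltONge leO_emb. Qed.

Lemma addO_emb u v : addO (omap emb u) (omap emb v) = omap emb (addO u v).
Proof. by move: u v => [g|] [h|] //=; rewrite embD. Qed.

Lemma minO_emb u v : minO (omap emb u) (omap emb v) = omap emb (minO u v).
Proof. by move: u v => [g|] [h|] //=; rewrite /oz_min emb_le; case: ifP. Qed.

Lemma is_val_emb (R : nzRingType) (mu : R -> option G) :
  is_val mu -> is_val (omap emb \o mu).
Proof.
move=> [h0 hM hD]; split=> [x|x y|x y] /=.
- by split=> [|/h0->//]; case e: (mu x) => // _; apply/h0.
- by rewrite hM addO_emb.
- by rewrite minO_emb leO_emb.
Qed.

End ConstantExtension.

(** * Gauss valuations and extension to fractions *)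

Section Gauss.
Variables (T : oZmodType) (F : fieldType) (W : F -> option T) (x : T).
Hypothesis W_val : is_val W.
Implicit Types f g : {poly F}.

Definition gterm f n := addO (W f`_n) (Some (x *+ n)).
Definition gauss f := \big[minO/None]_(n < size f) gterm f n.

Lemma gauss_ge t f : (forall n, leO t (gterm f n)) <-> leO t (gauss f).
Proof.
rewrite /gauss -(big_minO_ge (fun i : 'I__ => gterm f i)); split=> [h i|h n]; first exact: h.
case: (ltnP n (size f)) => [ln|/leq_sizeP/(_ n (leqnn n))]; first exact: (h (Ordinal ln)).
by rewrite /gterm => ->; rewrite (val_zero W_val) leO_None.
Qed.

Lemma gauss_le f n : leO (gauss f) (gterm f n).
Proof. by move: n; apply/gauss_ge; exact: leO_refl. Qed.

Lemma gauss0 : gauss 0 = None.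
Proof. by rewrite /gauss size_poly0 big_ord0. Qed.

Lemma gauss_neq0 f : f != 0 -> gauss f <> None.
Proof.
move=> nf e; have := gauss_le f (size f).-1; rewrite e /gterm.
have [|g -> //] := val_neq0 W_val (x := f`_(size f).-1).
by rewrite -lead_coefE lead_coef_eq0.
Qed.

(** Taking the least index makes the inequality strict below it, which isolates a single term of a
    product in [gaussM]. *)
Lemma gauss_first f : f != 0 ->
  exists n, gterm f n = gauss f /\ forall k, (k < n)%N -> ltO (gauss f) (gterm f k).
Proof.
move=> nf; have ex : exists n, leO (gterm f n) (gauss f).
  case: (big_minO_attained (fun i : 'I_(size f) => gterm f i)) => [/(gauss_neq0 nf)//|[i e]].
  by exists i; rewrite /gauss e leO_refl.
case: (ex_minnP ex) => n hn hmin; exists n; split=> [|k kn].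
  by apply: leO_eq => //; exact: gauss_le.
by rewrite ltONge; apply: contraL kn => /hmin; rewrite -leqNgt.
Qed.

Lemma gtermD f g n : leO (minO (gterm f n) (gterm g n)) (gterm (f + g) n).
Proof.
rewrite /gterm coefD -leO_subl; apply: (valD_ge W_val);
  by rewrite leO_subl minO_le leO_refl ?orbT.
Qed.

Lemma gterm_conv f g k n : (k <= n)%N ->
  addO (W (f`_k * g`_(n - k))) (Some (x *+ n)) = addO (gterm f k) (gterm g (n - k)).
Proof.
by move=> kn; rewrite (val_mul W_val) /gterm addOACA /= -mulrnDr subnKC.
Qed.

Lemma gaussM f g : gauss (f * g) = addO (gauss f) (gauss g).
Proof.
have [->|nf] := eqVneq f 0; first by rewrite mul0r gauss0.
have [->|ng] := eqVneq g 0; first by rewrite mulr0 gauss0 addOC.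
apply: leO_eq; last first.
  (* Moving the shift [x *+ n] to the left leaves the bare value of a sum, to which the ultrametric
     bound applies. *)
  apply/gauss_ge => n; rewrite [gterm _ n]/gterm coefM -leO_subl; apply: (val_sum_ge W_val) => k _.
  by rewrite leO_subl gterm_conv -1?ltnS //; apply: leO_add; exact: gauss_le.
(* At the sum of the least indices attaining the two minima, a single term of the
   convolution has minimal value. *)
have [i [ei hi]] := gauss_first nf; have [j [ej hj]] := gauss_first ng.
apply: leO_trans (gauss_le _ (i + j)) _.
case eu: (addO (gauss f) (gauss g)) => [u|]; last exact: leO_None.
have li : (i < (i + j).+1)%N by rewrite ltnS leq_addr.
rewrite [X in leO X]/gterm coefM (bigD1 (Ordinal li)) //=.
have eij : addO (W (f`_i * g`_(i + j - i))) (Some (x *+ (i + j))) = Some u.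
  by rewrite gterm_conv ?leq_addr // addKn ei ej.
rewrite (valD_lt W_val) ?eij ?leO_refl //.
rewrite -(ltO_add2r (x *+ (i + j))) eij -ltO_subl; apply: (val_sum_gt W_val) => k nk.
rewrite -[Some _]/(addO (Some u) (Some _)) ltO_subl gterm_conv -1?ltnS // -eu.
have nk' : k != i :> nat by apply: contra nk => /eqP e; apply/eqP/val_inj.
(* One factor always lies below its least minimising index: either [k < i], or [k > i] and then
   [i + j - k < j]. *)
case: (ltngtP k i) => [ki|ik|e]; last by rewrite e eqxx in nk'.
  by apply: leO_ltO_add (hi _ ki) (gauss_le _ _); exact: gauss_neq0.
rewrite addOC (addOC (gterm f k)); apply: leO_ltO_add (hj _ _) (gauss_le _ _).
  exact: gauss_neq0.
by rewrite ltn_subLR ?ltn_add2r // -ltnS.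
Qed.

Lemma gauss_val : is_val gauss.
Proof.
split=> [f|f g|f g]; last 2 first.
- exact: gaussM.
- apply/gauss_ge => n; apply: leO_trans (gtermD f g n).
  by rewrite leO_min !minO_le !gauss_le orbT.
split=> [e|->]; last exact: gauss0.
by apply/eqP; apply: contraTT isT => /gauss_neq0.
Qed.

Lemma gaussC c : gauss c%:P = W c.
Proof.
apply: leO_eq; first by have := gauss_le c%:P 0; rewrite /gterm coefC eqxx mulr0n addO0.
apply/gauss_ge => -[|n]; rewrite /gterm coefC /=; first by rewrite mulr0n addO0 leO_refl.
by rewrite (val_zero W_val) leO_None.
Qed.

Lemma gauss_XaddC c : gauss ('X + c%:P) = minO (Some x) (W c).
Proof.
apply: leO_eq.
  rewrite leO_min; have := gauss_le ('X + c%:P) 0; have := gauss_le ('X + c%:P) 1.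
  rewrite /gterm !coefD !coefX !coefC /= add0r addr0 (val_one W_val) mulr0n addO0 => h1 ->.
  by move: h1; rewrite /= add0r mulr1n => ->.
apply/gauss_ge => -[|[|n]]; rewrite minO_le /gterm coefD coefX coefC /= ?addr0 ?add0r.
- by rewrite mulr0n addO0 leO_refl orbT.
- by rewrite (val_one W_val) /= add0r mulr1n oz_refl.
- by rewrite (val_zero W_val) leO_None.
Qed.

End Gauss.

Lemma fraction_numden (R : idomainType) (h : {fraction R}) :
  exists f k : R, k != 0 /\ h = f%:F / k%:F.
Proof.
elim/quotW: h => r; exists (frac r).1, (frac r).2; split; first exact: denom_ratioP.
apply: (canRL (mulfK _)); first by rewrite tofrac_eq0 denom_ratioP.
unlock FracField.tofrac; rewrite -[LHS]FracField.pi_mul; apply/eqmodP => /=.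
rewrite FracField.equivfE /FracField.mulf !numden_Ratio ?mulf_neq0 ?oner_neq0 ?denom_ratioP //.
by rewrite !mulr1 mulrC.
Qed.

(** * Passage from a domain to its field of fractions *)

Section FractionValuation.
Variables (T : oZmodType) (R : idomainType) (w : R -> option T).
Hypothesis w_val : is_val w.

(** The result for infinite [v] is a default; it is applied to values of nonzero denominators. *)
Definition subO (u v : option T) := if v is Some y then addO u (Some (- y)) else None.

(** A numerator and a denominator are picked by choice; [fracvalE] shows that the value does not
    depend on them. *)
Definition fracval (h : {fraction R}) : option T :=
  let: exist f fP := cid (fraction_numden h) in
  let: exist k _ := cid fP in subO (w f) (w k).

Lemma fracvalE f k : k != 0 -> fracval (f%:F / k%:F) = subO (w f) (w k).
Proof.
move=> nk; rewrite /fracval; case: cid => f' h'; case: cid => k' /= [nk' e].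
have {}e : f * k' = f' * k.
  by apply/eqP; rewrite -tofrac_eq !tofracM -eqr_div ?tofrac_eq0 // e.
have := congr1 w e; rewrite !(val_mul w_val).
have [y ->] := val_neq0 w_val nk; have [y' ->] := val_neq0 w_val nk'.
move: (w f) (w f') => [a|] [b|] //= [h]; congr Some.
by apply/eqP; rewrite -(inj_eq (addIr y)) subrK addrAC -h addrK.
Qed.

Lemma fracval_poly f : fracval f%:F = w f.
Proof.
have := fracvalE f (oner_neq0 R); rewrite tofrac1 divr1 => ->.
by rewrite (val_one w_val) /= oppr0 addO0.
Qed.

Lemma fracval_val : is_val fracval.
Proof.
split=> [h|h h'|h h'].
- split=> [|->]; last by rewrite -tofrac0 fracval_poly (val_zero w_val).
  have [f [k [nk ->]]] := fraction_numden h; rewrite fracvalE //.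
  have [y ->] := val_neq0 w_val nk; case e: (w f) => // _.
  by case: w_val => w0 _ _; rewrite ((w0 f).1 e) tofrac0 mul0r.
- have [f [k [nk ->]]] := fraction_numden h; have [f' [k' [nk' ->]]] := fraction_numden h'.
  rewrite mulf_div -!tofracM !fracvalE ?mulf_neq0 // !(val_mul w_val).
  have [y ->] := val_neq0 w_val nk; have [y' ->] := val_neq0 w_val nk'.
  by rewrite /= addOACA /= opprD.
- have [f [k [nk ->]]] := fraction_numden h; have [f' [k' [nk' ->]]] := fraction_numden h'.
  rewrite addf_div ?tofrac_eq0 // -!tofracM -tofracD !fracvalE ?mulf_neq0 //.
  have [y e] := val_neq0 w_val nk; have [y' e'] := val_neq0 w_val nk'.
  rewrite (val_mul w_val k) e e' /= -leO_subl; apply: (valD_ge w_val);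
    rewrite leO_subl minO_le (val_mul w_val) ?e ?e' /= -addOA /= opprD.
    by rewrite addrCA subrr addr0 leO_refl.
  by rewrite addrA subrr add0r leO_refl orbT.
Qed.

End FractionValuation.

(** * The group obtained by adjoining a realization of a cut *)

Section CutGroup.
Variable G : oZmodType.
Hypothesis G_div : forall (g : G) n, exists t, t *+ n.+1 = g.
Implicit Types (g s t : G) (m : int).

Lemma oz_mulrz_le m s t : (0 <= m)%R -> s <=z t -> s *~ m <=z t *~ m.
Proof. by case: m => [n|n] // _; exact: oz_lerMn2. Qed.

Lemma oz_mulrz_le0 m s t : (m <= 0)%R -> s <=z t -> t *~ m <=z s *~ m.
Proof.
move=> m0 st; rewrite -oz_leN -!mulrNz; apply: oz_mulrz_le => //.
by rewrite Num.Theory.oppr_ge0.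
Qed.

Lemma oz_mulrz_ge0 m t : (0 < m)%R -> (0 <=z t *~ m) = (0 <=z t).
Proof. by case: m => [[|n]|n] // _; exact: oz_mulrn_ge0. Qed.

Lemma oz_divz g m : m != 0 -> exists t, t *~ m = g.
Proof.
case: m => [[|n]|n] // _; first by have [t <-] := G_div g n; exists t.
by have [t e] := G_div (- g) n; exists t; rewrite NegzE mulrNz -pmulrn e opprK.
Qed.

Variable dl : @qcut G.
Hypothesis dl_cut : is_cut dl.

(* The pair [(m, g)] stands for [m x + g] with [x] filling the cut; it is
   nonnegative when [m s + g] is for some [s] on the side of the cut where [s] in
   place of [x] can only decrease the value. *)
Definition cutside m s := ((0 < m)%R -> qL dl s) /\ ((m < 0)%R -> qR dl s).

Definition cut_pos (p : (int * G)%type) := exists2 s, cutside p.1 s & 0 <=z p.2 + s *~ p.1.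

(** A sum of two nonnegative pairs needs one common witness. For [s <= s'], lowering [s'] to [s]
    loses nothing if [m' <= 0], and raising [s] to [s'] loses nothing if [0 <= m]. If neither holds,
    [s] is in the right part and [s'] in the left, which forces [s = s']. *)
Lemma cutside_add m m' s s' : cutside m s -> cutside m' s' ->
  exists2 t, cutside (m + m') t & s *~ m + s' *~ m' <=z t *~ (m + m').
Proof.
wlog ss' : m m' s s' / s <=z s' => [H|] cs cs'.
  case/orP: (oz_total s s') => h; first exact: H.
  by have [t] := H _ _ _ _ h cs' cs; rewrite addrC [s *~ m + _]addrC; exists t.
have ts : (m' <= 0)%R -> s *~ m + s' *~ m' <=z s *~ (m + m').
  by move=> h; rewrite mulrzDr oz_leD2l; exact: oz_mulrz_le0.
have ts' : (0 <= m)%R -> s *~ m + s' *~ m' <=z s' *~ (m + m').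
  by move=> h; rewrite mulrzDr oz_leD2r; exact: oz_mulrz_le.
case: cs cs' => [sL sR] [s'L s'R].
have [m'0|m'0] := boolP (m' <= 0)%R; have [m0|m0] := boolP (0 <= m)%R.
- have [h|h] := boolP (0 < m + m')%R.
    by exists s; [split=> ?; [apply: sL | apply: sR]; lia | exact: ts].
  by exists s'; [split=> ?; [apply: s'L | apply: s'R]; lia | exact: ts'].
- by exists s; [split=> ?; [apply: sL | apply: sR]; lia | exact: ts].
- by exists s'; [split=> ?; [apply: s'L | apply: s'R]; lia | exact: ts'].
have /(oz_le_eq ss') e : s' <=z s by apply: (@qcut_le_LR _ dl); [apply: s'L | apply: sR]; lia.
exists s; last by rewrite mulrzDr e oz_refl.
by split=> _; [rewrite e; apply: s'L | apply: sR]; lia.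
Qed.

Lemma cut_posD p q : cut_pos p -> cut_pos q -> cut_pos (p + q).
Proof.
move=> [s cs hs] [s' cs' hs']; have [t ct ht] := cutside_add cs cs'; exists t => //=.
apply: (oz_trans (y := (p.2 + q.2) + (s *~ p.1 + s' *~ q.1))); last by rewrite oz_leD2l.
by rewrite addrACA -[0]addr0; exact: oz_leD.
Qed.

(** For [m > 0] the witnesses [s] on the left and [r] on the right satisfy [m (s - r) >= 0], so they
    are equal and lie in both parts, which a cut excludes. *)
Lemma cut_pos_anti p : cut_pos p -> cut_pos (- p) -> p = 0.
Proof.
wlog m0 : p / (0 <= p.1)%R => [H|].
  have [|/negP h] := boolP (0 <= p.1)%R; first exact: H.
  move=> h1 h2; apply: oppr_inj; rewrite oppr0; apply: H; rewrite ?opprK //=; lia.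
case: p m0 => m g /= m0 [s [/= sL _] hs] [r [/= _ rR] hr].
have [m1|m1] := boolP (0 < m)%R; last first.
  have m2 : m = 0 by lia.
  rewrite m2 /= mulr0z addr0 in hs; rewrite m2 /= oppr0 mulr0z addr0 in hr.
  by rewrite m2 -(oz_le_eq hs _) // -oz_leN oppr0.
have ls := sL m1; have rr : qR dl r by apply: rR; lia.
have rs : r <=z s.
  rewrite -oz_subr_ge0 -(oz_mulrz_ge0 _ m1) mulrzBl.
  by have := oz_leD hs hr; rewrite addr0 addrACA subrr add0r mulrNz.
case: (dl_cut (g := s)); split=> //.
by rewrite (oz_le_eq (qcut_le_LR ls rr) rs).
Qed.

(** Divisibility enters here: the solution [t] of [m t = - g] lies in one of the two parts and is
    itself the witness. *)
Lemma cut_pos_total p : cut_pos p \/ cut_pos (- p).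
Proof.
case: p => m g; have [->|m0] := eqVneq m 0.
  case/orP: (oz_total 0 g) => h; [left|right]; exists 0; try by split.
    by rewrite mul0rz addr0.
  by rewrite mul0rz addr0 -oz_leN oppr0 opprK.
have [t e] := oz_divz (- g) m0.
have ht : 0 <=z g + t *~ m by rewrite e subrr oz_refl.
have ht' : 0 <=z - g + t *~ (- m) by rewrite mulrNz e subrr oz_refl.
have [m1|m1] := boolP (0 < m)%R.
  by case: (qcut_cover dl t) => h; [left|right]; exists t => //; split=> //= ?; lia.
by case: (qcut_cover dl t) => h; [right|left]; exists t => //; split=> //= ?; lia.
Qed.

Definition cut_le : rel (int * G)%type := fun p q => `[< cut_pos (q - p) >].

Lemma cut_le_refl : reflexive cut_le.
Proof.
move=> p; apply/asboolP; rewrite subrr; exists 0; first by split.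
by rewrite mul0rz addr0 oz_refl.
Qed.

Lemma cut_le_trans : transitive cut_le.
Proof.
move=> q p r /asboolP h /asboolP h'; apply/asboolP.
by rewrite -(subrKA q); exact: cut_posD.
Qed.

Lemma cut_le_anti : antisymmetric cut_le.
Proof.
move=> p q /andP[/asboolP h /asboolP h']; apply/eqP; rewrite -subr_eq0; apply/eqP.
by apply: cut_pos_anti h' _; rewrite opprB.
Qed.

Lemma cut_le_total : total cut_le.
Proof.
move=> p q; case: (cut_pos_total (q - p)) => h; apply/orP; [left|right]; apply/asboolP => //.
by rewrite -opprB.
Qed.

Lemma cut_lerD2r p q r : cut_le p q -> cut_le (p + r) (q + r).
Proof. by move=> /asboolP h; apply/asboolP; rewrite opprD addrACA subrr addr0. Qed.

Definition cut_group : oZmodType :=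
  @OZmod (int * G)%type cut_le cut_le_refl cut_le_trans cut_le_anti cut_le_total cut_lerD2r.

Definition cut_emb g : cut_group := (0, g).

Lemma cut_emb_le g h : (cut_emb g <=z cut_emb h) = (g <=z h).
Proof.
apply/asboolP/idP => [[s _]|gh]; rewrite ?/= ?subrr ?mulr0z ?addr0 ?oz_subr_ge0 //.
by exists 0; [split; rewrite /= subrr | rewrite /= subrr mulr0z addr0 oz_subr_ge0].
Qed.

Lemma cut_emb_realizes : realizes cut_emb dl ((1, 0) : cut_group).
Proof.
split=> [l ll|r rr|_ g [//]]; apply/asboolP.
- by exists l; [split | rewrite /= subr0 add0r mulr1z addNr oz_refl].
- exists r; first by split.
  by rewrite /= sub0r subr0 mulrNz mulr1z subrr oz_refl.
Qed.

End CutGroup.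

Lemma realizable (G : oZmodType) : (forall (g : G) n, exists t, t *+ n.+1 = g) ->
  forall dl : @qcut G, exists (T : oZmodType) (emb : G -> T) (x : T),
  [/\ forall g h, emb (g + h) = emb g + emb h,
      forall g h, (emb g <=z emb h) = (g <=z h) & realizes emb dl x].
Proof.
move=> G_div dl; have [cut|/existsNP[g /contrapT[gL gR]]] := pselect (is_cut dl).
  exists (cut_group G_div cut), (@cut_emb _ G_div _ cut), (1, 0); split=> //.
  - exact: cut_emb_le.
  - exact: cut_emb_realizes.
(* A quasi-cut that is no cut is principal and is realized by its common element [g], inside [G]
   itself. *)
exists G, id, g; split=> //; split=> [l ll|r rr|/(_ g) []//].
- exact: qcut_le_LR ll gR.
- exact: qcut_le_LR gL rr.
Qed.

(** * A realization determines its quasi-cut *)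

Section Realization.
Variables (G T : oZmodType) (emb : G -> T).
Hypothesis embD : forall g h, emb (g + h) = emb g + emb h.
Hypothesis emb_le : forall g h, (emb g <=z emb h) = (g <=z h).
Variables (dl : @qcut G) (x : T).
Hypothesis x_real : realizes emb dl x.

Lemma realizes_principal g : qL dl g -> qR dl g -> x = emb g.
Proof. by case: x_real => hL hR _ gL gR; apply: oz_le_eq; [exact: hR | exact: hL]. Qed.

Lemma realizes_not_cut g : x = emb g -> qL dl g /\ qR dl g.
Proof.
move=> e; have [cut|/existsNP[h /contrapT[hL hR]]] := pselect (is_cut dl).
  by case: x_real => _ _ /(_ cut g).
by have := realizes_principal hL hR; rewrite e => /(emb_inj emb_le) ->.
Qed.

(** An element on the wrong side would have image [x], and [realizes_not_cut] then puts it in both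
    parts. *)
Lemma realizes_qL g : qL dl g <-> emb g <=z x.
Proof.
case: x_real => hL hR _; split=> [/hL//|gx].
case: (qcut_cover dl g) => // /hR xg.
by have [] := realizes_not_cut (oz_le_eq xg gx).
Qed.

Lemma realizes_qR g : qR dl g <-> x <=z emb g.
Proof.
case: x_real => hL hR _; split=> [/hR//|xg].
case: (qcut_cover dl g) => // /hL gx.
by have [] := realizes_not_cut (oz_le_eq xg gx).
Qed.

End Realization.

(** With [g = - (t *~ m)] the sign becomes the comparison of the realization with the image of [t],
    which is read off from [dl] alone. *)
Lemma realizes_sign (G T T' : oZmodType) (emb : G -> T) (emb' : G -> T') dl x x' :
  (forall (g : G) n, exists t, t *+ n.+1 = g) ->
  (forall g h, emb (g + h) = emb g + emb h) -> (forall g h, (emb g <=z emb h) = (g <=z h)) ->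
  (forall g h, emb' (g + h) = emb' g + emb' h) -> (forall g h, (emb' g <=z emb' h) = (g <=z h)) ->
  realizes emb dl x -> realizes emb' dl x' ->
  forall g (m : int), (0 <=z emb g + x *~ m) = (0 <=z emb' g + x' *~ m).
Proof.
move=> G_div eD ele eD' ele' hx hx' g m.
have [->|m0] := eqVneq m 0.
  by rewrite !mulr0z !addr0 -(emb0 eD) -(emb0 eD') ele ele'.
have [t /(congr1 -%R)] := oz_divz G_div (- g) m0; rewrite opprK => <-.
rewrite !(embN eD, embMz eD, embN eD', embMz eD') ![- (_ *~ _) + _]addrC -!mulrzBl.
have xt : (emb t <=z x) = (emb' t <=z x').
  by apply/idP/idP => [/(realizes_qL ele hx)|/(realizes_qL ele' hx')];
    [move/(realizes_qL ele' hx') | move/(realizes_qL ele hx)].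
have tx : (x <=z emb t) = (x' <=z emb' t).
  by apply/idP/idP => [/(realizes_qR ele hx)|/(realizes_qR ele' hx')];
    [move/(realizes_qR ele' hx') | move/(realizes_qR ele hx)].
have [m1|m1] := boolP (0 < m)%R; first by rewrite !oz_mulrz_ge0 // !oz_subr_ge0.
have m2 : (0 < - m)%R by lia.
by rewrite -[m]opprK !(mulrNz _ (- m)) -!mulNrz !oz_mulrz_ge0 // !opprB !oz_subr_ge0.
Qed.

(** * Extensions of the valuation to rational functions *)

Lemma poly_split_ind (L : closedFieldType) (Pr : {poly L} -> Prop) :
  (forall c, c != 0 -> Pr c%:P) -> (forall c, Pr ('X - c%:P)) ->
  (forall f g, f != 0 -> g != 0 -> Pr f -> Pr g -> Pr (f * g)) ->
  forall f, f != 0 -> Pr f.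
Proof.
move=> hC hX hM f nf; have [r e] := closed_field_poly_normal f; rewrite e -mul_polyC.
have nl : lead_coef f != 0 by rewrite lead_coef_eq0.
have np (s : seq L) : \prod_(z <- s) ('X - z%:P) != 0.
  by apply: monic_neq0; exact: monic_prod_XsubC.
apply: (hM) => //; [by rewrite polyC_eq0 | exact: hC | elim: r {e} => [|z r IH]].
  by rewrite big_nil; apply: hC; exact: oner_neq0.
by rewrite big_cons; apply: (hM) => //; rewrite polyXsubC_eq0.
Qed.

Section Extensions.
Variables (L : closedFieldType) (G : oZmodType) (vbar : L -> option G).
Hypothesis hvbar : is_val vbar.
Hypothesis hG : forall g : G, exists c : L, vbar c = Some g.
Local Notation KX := {fraction {poly L}}.
Implicit Types (P Q : @vpkg L G) (N M : nest vbar) (dl : @qcut G).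

(* Roots in [L] make the value group divisible. *)
Lemma value_group_div (g : G) n : exists t, t *+ n.+1 = g.
Proof.
have [c e] := hG g; have /closed_rootP[r] : size ('X^(n.+1) - c%:P) != 1%N by rewrite size_XnsubC.
rewrite rootE !hornerE subr_eq0 => /eqP h.
have nr : r != 0.
  apply: contraTneq (val_Some hvbar e) => r0.
  by rewrite -h r0 expr0n negbK.
have [t et] := val_neq0 hvbar nr; exists t.
by apply: Some_inj; rewrite -e -h (val_exp hvbar _ et).
Qed.

(** * Valuations attached to pointed balls *)

Section Omega.
Variables (T : oZmodType) (emb : G -> T).
Hypothesis embD : forall g h, emb (g + h) = emb g + emb h.
Hypothesis emb_le : forall g h, (emb g <=z emb h) = (g <=z h).
Variables (x : T) (a : L).

Let W_val := is_val_emb embD emb_le hvbar.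

Lemma omega_genE f :
  omega_gen vbar emb x a f = gauss (omap emb \o vbar) x (f \Po ('X + a%:P)).
Proof.
rewrite /omega_gen /gauss size_comp_poly2 ?size_XaddC //.
by apply: eq_bigr => n _; rewrite /gterm /=; case: (vbar _).
Qed.

Lemma omega_gen_val : is_val (omega_gen vbar emb x a).
Proof.
have [h0 hM hD] := gauss_val x W_val.
split=> [f|f g|f g]; rewrite !omega_genE.
- rewrite h0; split=> [/eqP|->]; last by rewrite comp_poly0.
  by rewrite comp_poly2_eq0 ?size_XaddC // => /eqP.
- by rewrite comp_polyM hM.
- by rewrite comp_polyD hD.
Qed.

Lemma omega_genC c : omega_gen vbar emb x a c%:P = omap emb (vbar c).
Proof. by rewrite omega_genE comp_polyC (gaussC x W_val). Qed.

Lemma omega_gen_XsubC c :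
  omega_gen vbar emb x a ('X - c%:P) = minO (Some x) (omap emb (vbar (a - c))).
Proof.
by rewrite omega_genE comp_polyB comp_polyX comp_polyC -addrA -polyCB (gauss_XaddC x W_val).
Qed.

(** A realization of a cut equals no element of [G], so being above the left part is the same as
    being at least [x]; both clauses of [ball] thus become one closed inequality. *)
Lemma ball_realized dl c : realizes emb dl x ->
  ball vbar a dl c <-> leO (Some x) (omap emb (vbar (c - a))).
Proof.
move=> hx; split=> [[h1 h2]|h].
  have [cut|/existsNP[g /contrapT[gL gR]]] := pselect (is_cut dl); last first.
    by rewrite (realizes_principal hx gL gR) (leO_emb emb_le (Some g)); exact: h1.
  case e: (vbar _) => [h|] //=; apply/(realizes_qR emb_le hx).
  by case: (qcut_cover dl h) => // /(h2 cut); rewrite e ltONge leO_refl.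
split=> [g gL gR|cut l lL].
  by rewrite (realizes_principal hx gL gR) (leO_emb emb_le (Some g)) in h.
case e: (vbar _) h => [h|] //= /(realizes_qR emb_le hx) hR; rewrite oz_ltNge.
apply/negP => hl; apply: (cut l); split=> //.
by rewrite (oz_le_eq (qcut_le_LR lL hR) hl).
Qed.

Lemma extension_of_poly (w : {poly L} -> option T) (w_val : is_val w) :
  (forall c, w c%:P = omap emb (vbar c)) -> inV vbar (VPkg emb (fracval w)).
Proof.
move=> wC; split=> //=; first exact: fracval_val.
by move=> c; rewrite fracval_poly.
Qed.

End Omega.

Lemma omega_qcut_exists a dl : exists P, inV vbar P /\ is_omega_qcut vbar a dl P.
Proof.
have [T [emb [x [eD ele hx]]]] := realizable value_group_div dl.
have wv := omega_gen_val eD ele x a.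
exists (VPkg emb (fracval (omega_gen vbar emb x a))); split.
  by apply: (extension_of_poly eD ele wv) => c; exact: omega_genC.
by exists x; split=> // f; exact: fracval_poly.
Qed.

Definition lin P (c : L) := vmap P ('X - c%:P)%:F.

Lemma omega_qcut_lin a dl P : inV vbar P -> is_omega_qcut vbar a dl P ->
  exists2 x, realizes (vemb P) dl x &
    forall c, lin P c = minO (Some x) (omap (vemb P) (vbar (a - c))).
Proof.
move=> [_ eD ele _] [x [hx h]]; exists x => // c.
by rewrite /lin h (omega_gen_XsubC eD ele).
Qed.

(** * Reduction of equivalence and order to linear polynomials *)

Section Comparison.
Variables P Q : @vpkg L G.
Hypotheses (PV : inV vbar P) (QV : inV vbar Q).

(** By multiplicativity a common pair [(g, m)] describes both values of every nonzero rational
    function, and the last hypothesis equates the signs. The exponent [b c] records whether the new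
    generator occurs in the value at [c]. *)
Lemma Veq_of_lin (x : vgrp P) (y : vgrp Q) (d : L -> G) (b : L -> nat) :
  (forall c, lin P c = Some (vemb P (d c) + x *+ b c)) ->
  (forall c, lin Q c = Some (vemb Q (d c) + y *+ b c)) ->
  (forall g (m : int), (0 <=z vemb P g + x *~ m) = (0 <=z vemb Q g + y *~ m)) ->
  Veq P Q.
Proof.
move=> linP linQ sgn h; case: PV QV => [Pv PD Ple PC] [Qv QD Qle QC].
pose good (u : KX) := exists g (m : int),
  vmap P u = Some (vemb P g + x *~ m) /\ vmap Q u = Some (vemb Q g + y *~ m).
have goodM u v : good u -> good v -> good (u * v).
  move=> [g [m [e1 e2]]] [g' [m' [e1' e2']]]; exists (g + g'), (m + m').
  by rewrite (val_mul Pv) (val_mul Qv) e1 e2 e1' e2' /= PD QD !mulrzDr ![_ + _ + (_ *~ _ + _)]addrACA.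
have goodP (f : {poly L}) : f != 0 -> good f%:F.
  move: f; apply: poly_split_ind => [c nc|c|f f' _ _]; last by rewrite tofracM; exact: goodM.
  - have [g e] := val_neq0 hvbar nc; exists g, 0.
    by rewrite PC QC e !mulr0z !addr0.
  - by exists (d c), (b c)%:Z; rewrite -/(lin P c) -/(lin Q c) linP linQ !pmulrn.
have [f [k [nk ->]]] := fraction_numden h.
have [->|nf] := eqVneq f 0.
  by rewrite tofrac0 mul0r (val_zero Pv) (val_zero Qv).
have goodV u : good u -> good u^-1.
  move=> [g [m [e e']]]; exists (- g), (- m).
  by rewrite (val_inv Pv e) (val_inv Qv e') !(embN PD, embN QD) !mulrNz !opprD.
by have [g [m [-> ->]]] := goodM _ _ (goodP _ nf) (goodV _ (goodP _ nk)); exact: sgn.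
Qed.

(** Intermediate elements of [G] add up along a factorization, and a nonzero constant is its own
    intermediate value. *)
Lemma Vle_of_lin :
  (forall c, exists g, leO (lin P c) (Some (vemb P g)) /\ leO (Some (vemb Q g)) (lin Q c)) ->
  Vle P Q.
Proof.
move=> hlin; case: PV QV => [Pv PD Ple PC] [Qv QD Qle QC]; right.
apply: poly_split_ind => [c nc|c|f f' _ _ [g [h1 h2]] [g' [h1' h2']]]; last 1 first.
- exists (g + g'); rewrite !tofracM (val_mul Pv) (val_mul Qv) PD QD.
  by split; [exact: (leO_add h1 h1') | exact: (leO_add h2 h2')].
- have [g e] := val_neq0 hvbar nc; exists g.
  by rewrite PC QC e /= !oz_refl.
- exact: hlin.
Qed.

(** Equivalence only tests against 0; division by a constant of value [g] moves the threshold to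
    [g]. *)
Lemma Veq_ge h g : Veq P Q ->
  leO (Some (vemb P g)) (vmap P h) = leO (Some (vemb Q g)) (vmap Q h).
Proof.
have [c e] := hG g; case: PV QV => [Pv PD Ple PC] [Qv QD Qle QC] /(_ (h / (c%:P)%:F)).
have := PC c; have := QC c; rewrite e => Qc Pc.
rewrite (val_mul Pv) (val_mul Qv) (val_inv Pv Pc) (val_inv Qv Qc).
by rewrite -!leO_subl !opprK /= !add0r.
Qed.

Lemma Veq_le h g : Veq P Q ->
  leO (vmap P h) (Some (vemb P g)) = leO (vmap Q h) (Some (vemb Q g)).
Proof.
case: PV QV => [Pv PD Ple PC] [Qv QD Qle QC].
have [-> _|nh] := eqVneq h 0; first by rewrite (val_zero Pv) (val_zero Qv).
have [z ez] := val_neq0 Pv nh; have [z' ez'] := val_neq0 Qv nh.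
have [c e] := hG g; move/(_ ((c%:P)%:F / h)).
have := PC c; have := QC c; rewrite e => Qc Pc.
by rewrite (val_mul Pv) (val_mul Qv) (val_inv Pv ez) (val_inv Qv ez') Pc Qc ez ez' /= !oz_subr_ge0.
Qed.

(** What both alternatives of [Vle] have in common: lower bounds from [G], weak or strict, pass from
    [P] to [Q]. Every deduction from [Vle] to balls goes through these bounds. *)
Lemma Vle_lin c g : Vle P Q ->
  (leO (Some (vemb P g)) (lin P c) -> leO (Some (vemb Q g)) (lin Q c)) /\
  (ltO (Some (vemb P g)) (lin P c) -> ltO (Some (vemb Q g)) (lin Q c)).
Proof.
case=> [e|/(_ ('X - c%:P))].
  by split; rewrite ?ltONge /lin ?(Veq_ge _ _ e) ?(Veq_le _ _ e).
case: PV QV => [Pv PD Ple PC] [Qv QD Qle QC].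
rewrite polyXsubC_eq0 => /(_ isT) [g' [h1 h2]]; split=> h.
  by apply: leO_trans h2; have := leO_trans h h1; rewrite /= Ple Qle.
apply: ltO_le_trans h2; have := ltO_le_trans h h1.
by rewrite !ltONge /= Ple Qle.
Qed.

End Comparison.

Lemma inV_val P : inV vbar P -> is_val (omap (vemb P) \o vbar).
Proof. by case=> _ PD Ple _; exact: is_val_emb. Qed.

Lemma minO_Some (g : G) u : exists h, minO (Some g) u = Some h.
Proof. by case: u => [h|] /=; [exists (oz_min g h) | exists g]. Qed.

Lemma realizes_congr (T : oZmodType) (emb : G -> T) dl dl' x :
  qcut_eq dl dl' -> realizes emb dl' x -> realizes emb dl x.
Proof.
move=> [eL eR] [hL hR hc]; split=> [l /eL|r /eR|cut]; [exact: hL | exact: hR |].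
by apply: hc => g [/eL gL /eR gR]; exact: (cut g).
Qed.

Lemma min_recenter (T : oZmodType) (W : L -> option T) t a b c : is_val W ->
  leO t (W (a - b)) -> minO t (W (a - c)) = minO t (W (b - c)).
Proof.
move=> Wv tab; have tba : leO t (W (b - a)) by rewrite (valBC Wv).
by apply: leO_eq; rewrite leO_min minO_le leO_refl /=;
   [apply: (val_ultra Wv (y := a)) | apply: (val_ultra Wv (y := b))];
   rewrite minO_le ?tab ?tba ?leO_refl ?orbT.
Qed.

Lemma min_recenter_emb P t a b c : inV vbar P -> leO t (omap (vemb P) (vbar (a - b))) ->
  minO t (omap (vemb P) (vbar (a - c))) = minO t (omap (vemb P) (vbar (b - c))).
Proof. by move=> PV; exact: (min_recenter c (inV_val PV)). Qed.

Lemma Veq_of_omega_lin a dl P Q x y : inV vbar P -> inV vbar Q ->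
  realizes (vemb P) dl x -> realizes (vemb Q) dl y ->
  (forall c, lin P c = minO (Some x) (omap (vemb P) (vbar (a - c)))) ->
  (forall c, lin Q c = minO (Some y) (omap (vemb Q) (vbar (a - c)))) ->
  Veq P Q.
Proof.
move=> PV QV hx hy linP linQ.
(* Inside the ball the value at [c] is the generator itself; outside it is [vbar (a - c)], finite
   because [a] is in the ball, so the default 0 is never reached. *)
pose d c := if `[< ball vbar a dl c >] then 0 else odflt 0 (vbar (a - c)).
have linE R z : inV vbar R -> realizes (vemb R) dl z ->
    (forall c, lin R c = minO (Some z) (omap (vemb R) (vbar (a - c)))) ->
    forall c, lin R c = Some (vemb R (d c) + z *+ `[< ball vbar a dl c >]).
  move=> [_ RD Rle _] hz linR c; rewrite linR /d (valBC hvbar).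
  case: asboolP => [/(ball_realized Rle a c hz) h|nb].
    by rewrite minO_l // (emb0 RD) add0r mulr1n.
  have : ltO (omap (vemb R) (vbar (c - a))) (Some z).
    by rewrite ltONge; apply/negP => /(ball_realized Rle a c hz).
  case: (vbar _) => [g|] //= h; rewrite mulr0n addr0; apply: (minO_r (u := Some z) (v := Some _)).
  exact: (ltOW (u := Some _) (v := Some _)).
case: (PV) (QV) => [_ PD Ple _] [_ QD Qle _].
apply: (Veq_of_lin PV QV (linE P x PV hx linP) (linE Q y QV hy linQ)).
exact: (realizes_sign value_group_div PD Ple QD Qle hx hy).
Qed.

(** * Inclusion of balls and order of quasi-cuts *)

Lemma cball_sub a g b e :
  (forall c, cball vbar b e c -> cball vbar a g c) <-> cball vbar a g b /\ g <=z e.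
Proof.
split=> [sub|[ab ge] c bc].
  have ab : cball vbar a g b by apply: sub; rewrite /cball subrr (val_zero hvbar).
  (* The point [b + d] lies at distance exactly [e] from [b], so the ball remembers its radius. *)
  split=> //; have [d ed] := hG e; have bd : b + d - b = d by rewrite addrAC subrr add0r.
  have h : cball vbar a g (b + d) by apply: sub; rewrite /cball bd ed leO_refl.
  rewrite -[g <=z e]/(leO (Some g) (Some e)) -ed -bd.
  by apply: (val_ultra hvbar (y := a)) => //; rewrite (valBC hvbar).
apply: (val_ultra hvbar (y := b)) => //.
by apply: leO_trans bc; exact: ge.
Qed.

Lemma ball_nonempty a dl : ball vbar a dl a.
Proof.
split=> [g _ _|_ l _]; by rewrite subrr (val_zero hvbar).
Qed.

Lemma ball_sub_of_center a a' dl dl' : qcut_le dl dl' -> ball vbar a dl a' ->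
  forall c, ball vbar a' dl' c -> ball vbar a dl c.
Proof.
have [T [emb [x [eD ele hx]]]] := realizable value_group_div dl.
have [T' [emb' [y [eD' ele' hy]]]] := realizable value_group_div dl'.
move=> [hL hR] /(ball_realized ele a a' hx) haa' c /(ball_realized ele' a' c hy) hc.
apply/(ball_realized ele a c hx).
apply: (val_ultra (is_val_emb eD ele hvbar) (y := a')) => //=.
(* [x] and [y] live in different groups; the bound is carried over by the right parts of the
   quasi-cuts, inside [G]. *)
case: (vbar _) hc => [h|] //= /(realizes_qR ele' hy) /hR; exact: (realizes_qR ele hx h).1.
Qed.

(** Supplies the intermediate element required by [Vle]. If there is none, the covering property
    turns both inclusions into equalities. *)
Lemma qcut_between dl dl' : qcut_le dl dl' ->
  qcut_eq dl dl' \/ exists g, qR dl g /\ qL dl' g.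
Proof.
move=> [hL hR]; have [h|nh] := pselect (exists g, qR dl g /\ qL dl' g); first by right.
left; split=> g; split; [exact: hL| |  |exact: hR] => hg.
- case: (qcut_cover dl g) => // gR; by case: nh; exists g.
- case: (qcut_cover dl' g) => // gL; by case: nh; exists g.
Qed.

Section TwoQuasicuts.
Variables (a a' : L) (dl dl' : @qcut G) (P Q : @vpkg L G).
Hypotheses (PV : inV vbar P) (QV : inV vbar Q).
Hypotheses (Pom : is_omega_qcut vbar a dl P) (Qom : is_omega_qcut vbar a' dl' Q).

Lemma Beq_qcut_Veq : Beq (BQ a dl : Bel vbar) (BQ a' dl') -> Veq P Q.
Proof.
move=> [eb eq]; have [x hx linP] := omega_qcut_lin PV Pom.
have [y hy linQ] := omega_qcut_lin QV Qom; have hy' := realizes_congr eq hy.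
case: (QV) => [_ QD Qle _].
apply: (Veq_of_omega_lin PV QV hx hy' linP) => c; rewrite linQ.
apply: (min_recenter_emb c QV); rewrite (valBC hvbar).
by apply/(ball_realized Qle a' a hy)/eb; exact: ball_nonempty.
Qed.

Lemma Ble_qcut_Vle : Ble (BQ a dl : Bel vbar) (BQ a' dl') -> Vle P Q.
Proof.
move=> [sub le]; have [x hx linP] := omega_qcut_lin PV Pom.
have [y hy linQ] := omega_qcut_lin QV Qom.
case: (PV) (QV) => [_ PD Ple _] [_ QD Qle _].
have aa' := sub _ (ball_nonempty a' dl').
case: (qcut_between le) => [eq|[g [gR gL]]].
  left; apply: Beq_qcut_Veq; split=> // c; split; last exact: sub.
  apply: ball_sub_of_center; first by case: eq => e1 e2; split=> u; [case: (e1 u)|case: (e2 u)].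
  have [T [emb [z [eD ele hz]]]] := realizable value_group_div dl'.
  apply/(ball_realized ele a' a hz); rewrite (valBC hvbar).
  by apply/(ball_realized ele a a' (realizes_congr eq hz)).
(* As [g] separates [x] from [y], the minimum of [g] and [vbar (a' - c)] separates the two values at
   [c]. *)
apply: (Vle_of_lin PV QV) => c; have [h eh] := minO_Some g (vbar (a' - c)).
have ehR (R : @vpkg L G) : Some (vemb R h) = omap (vemb R) (minO (Some g) (vbar (a' - c))).
  by rewrite eh.
exists h; rewrite linP linQ !ehR -!minO_emb //.
have xg := (realizes_qR Ple hx g).1 gR; have gy := (realizes_qL Qle hy g).1 gL.
rewrite (@min_recenter_emb P _ a a' c PV); last first.
  by rewrite (valBC hvbar); apply/(ball_realized Ple a a' hx).
split; rewrite leO_min !minO_le leO_refl orbT andbT.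
  by rewrite -[leO (Some x) _]/(x <=z _) xg.
by rewrite -[leO _ (Some y)]/(vemb Q g <=z y) gy.
Qed.

(** Testing at the centre [a] suffices: [lin P a] is [x], while [lin Q a] is at most both [y] and
    the value of [a' - a]. The first bound orders the quasi-cuts, the second puts [a'] in the ball
    around [a]. *)
Lemma Vle_qcut_Ble : Vle P Q -> Ble (BQ a dl : Bel vbar) (BQ a' dl').
Proof.
move=> le; have hc c g := Vle_lin PV QV c g le.
have [x hx linP] := omega_qcut_lin PV Pom; have [y hy linQ] := omega_qcut_lin QV Qom.
case: (PV) (QV) => [_ PD Ple _] [_ QD Qle _].
have linPa : lin P a = Some x by rewrite linP subrr (val_zero hvbar).
have linQle : leO (lin Q a) (Some y) by rewrite linQ minO_le leO_refl.
have cuts : qcut_le dl dl'.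
  split=> g; rewrite ?(realizes_qL Ple hx g) ?(realizes_qL Qle hy g) => h.
    by have := (hc a g).1; rewrite linPa => /(_ h) /leO_trans/(_ linQle).
  apply/(realizes_qR Ple hx g); rewrite -[_ <=z _]negbK -oz_ltNge; apply/negP => h'.
  have := (hc a g).2; rewrite linPa => /(_ h') /ltO_le_trans/(_ linQle).
  by rewrite ltONge /=; move/(realizes_qR Qle hy g): h => ->.
split=> //; apply: ball_sub_of_center => //.
split=> [g gL gR|cut l lL].
  rewrite (valBC hvbar) -(leO_emb Qle).
  have h : leO (Some (vemb P g)) (lin P a) by rewrite linPa; exact/(realizes_qL Ple hx g).
  by have := (hc a g).1 h; rewrite linQ leO_min (valBC hvbar) => /andP[].
rewrite (valBC hvbar) -(ltO_emb Qle).
have h : ltO (Some (vemb P l)) (lin P a).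
  rewrite linPa ltONge; apply/negP => /(realizes_qR Ple hx) lR; exact: (cut l).
by have := (hc a l).2 h; rewrite linQ ltO_min (valBC hvbar) => /andP[].
Qed.

End TwoQuasicuts.

(** * Nests of balls *)

Lemma nest_avoid N c : exists a g, nmem N a g /\ ltO (vbar (a - c)) (Some g).
Proof.
have [a [g [Nag h]]] := nest_empty N c; exists a, g; split=> //.
by rewrite ltONge (valBC hvbar); apply/negP.
Qed.

Lemma nest_chain_le N a g b e : nmem N a g -> nmem N b e ->
  (cball vbar b e a /\ e <=z g) \/ (cball vbar a g b /\ g <=z e).
Proof.
move=> Na Nb; case: (nest_chain Na Nb) => h; [left|right]; exact/cball_sub.
Qed.

Definition om a g : {poly L} -> option G := omega_gen vbar id g a.

Lemma om_val a g : is_val (om a g).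
Proof. exact: omega_gen_val. Qed.

Lemma omC a g c : om a g c%:P = vbar c.
Proof. by rewrite /om omega_genC //; case: (vbar c). Qed.

Lemma om_XsubC a g c : om a g ('X - c%:P) = minO (Some g) (vbar (a - c)).
Proof. by rewrite /om omega_gen_XsubC //; case: (vbar (a - c)). Qed.

Lemma om_mono a g b e f : cball vbar a g b -> g <=z e -> leO (om a g f) (om b e f).
Proof.
move=> ab ge; have [->|] := eqVneq f 0; first by rewrite (val_zero (om_val b e)) leO_None.
move: f; apply: poly_split_ind => [c _|c|f f' _ _ h h'].
- by rewrite !omC leO_refl.
- rewrite !om_XsubC (@min_recenter _ _ _ a b c hvbar) 1?(valBC hvbar) //.
  by rewrite leO_min !minO_le leO_refl orbT -[leO (Some g) (Some e)]/(g <=z e) ge.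
- by rewrite !(val_mul (om_val _ _)); exact: leO_add.
Qed.

(** The values stabilise: on [X - c] from any ball avoiding [c] on, and on a product from the
    smaller of the two balls that serve its factors. *)
Lemma nest_om_max N f : exists u, (exists a g, nmem N a g /\ om a g f = u) /\
  forall a g, nmem N a g -> leO (om a g f) u.
Proof.
have [->|] := eqVneq f 0.
  have [a [g [Nag _]]] := nest_avoid N 0.
  exists None; split; first by exists a, g; rewrite (val_zero (om_val a g)).
  by move=> b e _; exact: leO_None.
suff h : f != 0 -> exists a g, nmem N a g /\
    forall b e, nmem N b e -> leO (om b e f) (om a g f).
  by move=> /h[a [g [Nag h']]]; exists (om a g f); split=> //; exists a, g.
move: f; apply: poly_split_ind => [c _|c|f f' _ _ [a [g [Na ha]]] [a' [g' [Na' ha']]]].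
- have [a [g [Nag _]]] := nest_avoid N 0; exists a, g; split=> // b e _.
  by rewrite !omC leO_refl.
- have [a [g [Nag far]]] := nest_avoid N c; exists a, g; split=> // b e Nb.
  case: (nest_chain_le Nag Nb) => [[ba eg]|[ab ge]]; first exact: om_mono.
  rewrite !om_XsubC (minO_r (ltOW far)) minO_le.
  have fab : ltO (vbar (c - a)) (vbar (a - b)).
    by rewrite (valBC hvbar c a) (valBC hvbar a b); exact: ltO_le_trans far ab.
  by rewrite (valBC hvbar a c) -(val_isosceles hvbar fab) (valBC hvbar c b) leO_refl orbT.
- have [a'' [g'' [N'' h h']]] : exists a'' g'', [/\ nmem N a'' g'',
      forall b e, nmem N b e -> leO (om b e f) (om a'' g'' f) &
      forall b e, nmem N b e -> leO (om b e f') (om a'' g'' f')].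
    case: (nest_chain_le Na Na') => [[ba eg]|[ab ge]]; [exists a, g|exists a', g'];
      split=> // b e /[dup] Nb; [move/ha'|move/ha] => /leO_trans; apply; exact: om_mono.
  exists a'', g''; split=> // b e Nb; rewrite !(val_mul (om_val _ _)).
  by apply: leO_add; auto.
Qed.

(** Each valuation axiom involves at most three polynomials. Some ball of the nest attains all three
    maxima, and there the axiom is one for [om]. *)
Lemma omega_nest_exists N : exists P, inV vbar P /\ is_omega_nest N P.
Proof.
have [w hw] := choice (nest_om_max N).
have deeper f f' : exists a g, [/\ nmem N a g, om a g f = w f & om a g f' = w f'].
  have [[a [g [Na e]]] _] := hw f; have [[a' [g' [Na' e']]] _] := hw f'.
  case: (nest_chain_le Na Na') => [[ba eg]|[ab ge]]; [exists a, g|exists a', g'];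
    split=> //; apply: leO_eq; rewrite ?(hw _).2 // -?e -?e'; exact: om_mono.
have deeper3 f f' f'' : exists a g, [/\ nmem N a g, om a g f = w f, om a g f' = w f' &
    om a g f'' = w f''].
  have [a [g [Na e e']]] := deeper f f'; have [a' [g' [Na' e'' _]]] := deeper f'' f''.
  case: (nest_chain_le Na Na') => [[ba eg]|[ab ge]]; [exists a, g|exists a', g'];
    split=> //; apply: leO_eq; rewrite ?(hw _).2 // -?e -?e' -?e''; exact: om_mono.
have wv : is_val w.
  split=> [f|f f'|f f'].
  - have [a [g [_ <- _]]] := deeper f f; case: (om_val a g) => h _ _; exact: h.
  - have [a [g [_ <- <- <-]]] := deeper3 f f' (f * f'); exact: (val_mul (om_val a g)).
  - have [a [g [_ <- <- <-]]] := deeper3 f f' (f + f').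
    by case: (om_val a g) => _ _ h; exact: h.
exists (VPkg id (fracval w)); split.
  apply: extension_of_poly => // c; have [a [g [_ <- _]]] := deeper c%:P c%:P.
  by rewrite omC; case: (vbar c).
move=> f nf; have [g eg] := val_neq0 wv nf; exists g.
rewrite /= fracval_poly // eg -eg; have [[a [e [Na ea]]] h] := hw f; split=> //.
by exists a, e.
Qed.

Section NestValuation.
Variables (N : nest vbar) (P : @vpkg L G).
Hypotheses (PV : inV vbar P) (Nom : is_omega_nest N P).

Lemma omega_nest_lin_ge a g c : nmem N a g ->
  leO (omap (vemb P) (minO (Some g) (vbar (a - c)))) (lin P c).
Proof.
have nX : 'X - c%:P != 0 :> {poly L} by rewrite polyXsubC_eq0.
have [h [e _ hb]] := Nom nX; case: (PV) => _ _ Ple _.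
move=> /hb; rewrite -/(om a g _) om_XsubC /lin e -[Some (vemb P h)]/(omap (vemb P) (Some h)).
by rewrite leO_emb.
Qed.

Lemma omega_nest_lin a g c : nmem N a g -> ltO (vbar (a - c)) (Some g) ->
  lin P c = omap (vemb P) (vbar (a - c)).
Proof.
move=> Na far; apply: leO_eq; last first.
  by have := omega_nest_lin_ge c Na; rewrite (minO_r (ltOW far)).
have nX : 'X - c%:P != 0 :> {poly L} by rewrite polyXsubC_eq0.
(* The maximum is attained on a ball around [b]; whether this ball contains or is contained in the
   one around [a], its value at [c] is no larger. *)
have [h [e [b [e' [Nb eb]]] _]] := Nom nX; case: (PV) => _ _ Ple _.
rewrite /lin e -[Some (vemb P h)]/(omap (vemb P) (Some h)) leO_emb // -eb.
rewrite -[vbar (a - c)](minO_r (ltOW far)) -om_XsubC -/(om _ _ _).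
case: (nest_chain_le Na Nb) => [[ba eg]|[ab ge]]; first exact: om_mono.
rewrite !om_XsubC (minO_r (ltOW far)) minO_le.
have fab : ltO (vbar (c - a)) (vbar (a - b)).
  by rewrite (valBC hvbar c a) (valBC hvbar a b); exact: ltO_le_trans far ab.
by rewrite (valBC hvbar a c) -(val_isosceles hvbar fab) (valBC hvbar c b) leO_refl orbT.
Qed.

End NestValuation.

(** Nest valuations take no values outside [G], so [Veq_of_lin] applies with the extra generator set
    to 0. *)
Lemma Veq_of_finite_lin P Q : inV vbar P -> inV vbar Q ->
  (forall c, exists g, lin P c = Some (vemb P g) /\ lin Q c = Some (vemb Q g)) -> Veq P Q.
Proof.
move=> PV QV /choice[d hd]; case: (PV) (QV) => [_ PD Ple _] [_ QD Qle _].
apply: (Veq_of_lin PV QV (x := 0) (y := 0) (d := d) (b := fun=> 0)) => [c|c|g m].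
- by rewrite addr0; case: (hd c).
- by rewrite addr0; case: (hd c).
- by rewrite !mul0rz !addr0 -(emb0 PD) -(emb0 QD) Ple Qle.
Qed.

(** * Comparisons that involve nests *)

Section NestComparison.
Variables (N M : nest vbar) (a : L) (dl : @qcut G) (P Q R : @vpkg L G).
Hypotheses (PV : inV vbar P) (QV : inV vbar Q) (RV : inV vbar R).
Hypotheses (Pom : is_omega_nest N P) (Qom : is_omega_nest M Q) (Rom : is_omega_qcut vbar a dl R).

Lemma nest_equiv_Veq : nest_equiv N M -> Veq P Q.
Proof.
move=> [NM _]; apply: (Veq_of_finite_lin PV QV) => c.
have [b [g [Nb far]]] := nest_avoid N c.
have [b' [e [Mb' /cball_sub[bb' ge]]]] := NM _ _ Nb.
have fbb' : ltO (vbar (c - b)) (vbar (b - b')).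
  by rewrite (valBC hvbar c b) (valBC hvbar b b'); exact: ltO_le_trans far bb'.
have eb : vbar (b' - c) = vbar (b - c).
  by rewrite (valBC hvbar b' c) (val_isosceles hvbar fbb') (valBC hvbar c b).
have far' : ltO (vbar (b' - c)) (Some e) by rewrite eb; exact: ltO_le_trans far _.
rewrite (omega_nest_lin PV Pom Nb far) (omega_nest_lin QV Qom Mb' far') eb.
by case: (vbar _) far => // h _; exists h.
Qed.

Lemma Vle_nest_equiv : Vle P Q -> nest_equiv N M.
Proof.
move=> le; have hc c g := Vle_lin PV QV c g le.
case: (PV) (QV) => [_ PD Ple _] [_ QD Qle _].
have NM : cofinal N M.
  move=> b g Nb; have [b' [e [Mb' far]]] := nest_avoid M b; exists b', e; split=> //.
  have gb : leO (Some (vemb P g)) (lin P b).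
    have := omega_nest_lin_ge PV Pom b Nb.
    by rewrite subrr (val_zero hvbar) (minO_l (leO_None _)).
  have := (hc b g).1 gb; rewrite (omega_nest_lin QV Qom Mb' far).
  rewrite -[Some (vemb Q g)]/(omap _ (Some g)) leO_emb // => bb'.
  by apply/cball_sub; split; last exact: (leO_trans bb' (ltOW far)).
(* The other cofinality follows from the first: a ball of [N] avoiding [b] contains a ball of [M].
   That one cannot contain the ball around [b], so it lies inside it; the ball of [N] then meets the
   ball around [b] without containing [b], hence lies inside it too. *)
split=> // b e Mb; have [a' [g [Na' far]]] := nest_avoid N b.
exists a', g; split=> //; have [b' [e' [Mb' /cball_sub[a'b' ge']]]] := NM _ _ Na'.
have nb : ~ cball vbar a' g b.
  by rewrite /cball (valBC hvbar) => h; move: far; rewrite ltONge h.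
apply/cball_sub; case: (nest_chain_le Mb Mb') => [[b'b eb]|[bb' ee']].
  case: nb; apply: (val_ultra hvbar (y := b')) => //.
  by apply: leO_trans b'b; exact: ge'.
have ba' : ltO (vbar (b - a')) (vbar (a' - b')).
  by rewrite (valBC hvbar b a') (valBC hvbar a' b'); exact: ltO_le_trans far a'b'.
have eb : leO (Some e) (vbar (a' - b)).
  by rewrite (valBC hvbar a' b) -(val_isosceles hvbar ba') (valBC hvbar b b').
split=> //; exact: (leO_trans eb (ltOW far)).
Qed.

(** At the centre [b] of a ball of [N] avoiding [a], the value under [P] is at least the radius,
    whereas under [R] it is at most [vbar (a - b)], which is smaller. *)
Lemma nest_not_le_qcut : ~ Vle P R.
Proof.
move=> le; have [b [g [Nb far]]] := nest_avoid N a.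
have [x hx linR] := omega_qcut_lin RV Rom.
have gb : leO (Some (vemb P g)) (lin P b).
  have := omega_nest_lin_ge PV Pom b Nb.
  by rewrite subrr (val_zero hvbar) (minO_l (leO_None _)).
have := (Vle_lin PV RV b g le).1 gb; case: (RV) => [_ _ Rle _].
rewrite linR leO_min => /andP[_]; rewrite -[Some (vemb R g)]/(omap _ (Some g)) leO_emb //.
by rewrite (valBC hvbar) => h; move: far; rewrite ltONge h.
Qed.

Lemma Ble_qcut_nest_Vle : Ble (BQ a dl) (BN N) -> Vle R P.
Proof.
move=> [b [e [Nb sub]]]; have [x hx linR] := omega_qcut_lin RV Rom.
case: (PV) (RV) => [_ PD Ple _] [_ RD Rle _].
apply: (Vle_of_lin RV PV) => c; have [h eh] := minO_Some e (vbar (b - c)).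
have ehS (S : @vpkg L G) : Some (vemb S h) = omap (vemb S) (minO (Some e) (vbar (b - c))).
  by rewrite eh.
exists h; rewrite !ehS; split; last exact: (omega_nest_lin_ge PV Pom).
have ab : leO (Some x) (omap (vemb R) (vbar (a - b))).
  rewrite (valBC hvbar); apply/(ball_realized Rle a b hx)/sub.
  by rewrite /cball subrr (val_zero hvbar).
have xe : x <=z vemb R e.
  have [d ed] := hG e; have bd : b + d - b = d by rewrite addrAC subrr add0r.
  have h' : ball vbar a dl (b + d) by apply: sub; rewrite /cball bd ed leO_refl.
  rewrite -[x <=z _]/(leO (Some x) (omap (vemb R) (Some e))) -ed -bd.
  apply: (val_ultra (inV_val RV) (y := a)); first exact/(ball_realized Rle a _ hx).
  exact: ab.
rewrite linR (@min_recenter_emb R _ a b c RV) // -minO_emb //.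
by rewrite leO_min !minO_le leO_refl orbT andbT -[leO (Some x) _]/(x <=z vemb R e) xe.
Qed.

Lemma Vle_Ble_qcut_nest : Vle R P -> Ble (BQ a dl) (BN N).
Proof.
move=> le; have [b [g [Nb far]]] := nest_avoid N a; exists b, g; split=> //.
have [x hx linR] := omega_qcut_lin RV Rom.
have linRa : lin R a = Some x by rewrite linR subrr (val_zero hvbar).
case: (PV) (RV) => [_ PD Ple _] [_ RD Rle _].
have linPa := omega_nest_lin PV Pom Nb far.
case eh: (vbar (b - a)) far linPa => [h|] //= hg linPa.
(* Otherwise the strict bound [h] at [a] would pass from [R] to [P], where the value at [a] is
   exactly [h]. *)
have xh : x <=z vemb R h.
  apply: contraT; rewrite -oz_ltNge => hx'.
  have := (Vle_lin RV PV a h le).2; rewrite linRa linPa => /(_ hx').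
  by rewrite ltONge leO_refl.
have xg : x <=z vemb R g.
  by apply: oz_trans xh _; rewrite Rle; exact: (ltOW (u := Some h) (v := Some g)).
move=> c hc; apply/(ball_realized Rle a c hx).
apply: (val_ultra (inV_val RV) (y := b)); last by rewrite /= eh.
apply: (leO_trans (v := Some (vemb R g)) (u := Some x)) => //.
by have := hc; rewrite /cball -(leO_emb Rle).
Qed.

End NestComparison.

(** * Surjectivity and the order isomorphism *)

(** Lets distances in [L] be read off from [lin P], as the next two lemmas do. *)
Lemma const_shift (b c : L) : ((c - b)%:P)%:F = ('X - b%:P)%:F - ('X - c%:P)%:F :> KX.
Proof. by rewrite -tofracB polyCB; congr (_%:F); rewrite opprB [RHS]addrC subrKA. Qed.

Lemma lin_near P b c : inV vbar P -> leO (lin P b) (lin P c) ->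
  leO (lin P b) (omap (vemb P) (vbar (c - b))).
Proof.
move=> [Pv _ _ PC] h; rewrite -PC const_shift; apply: (valD_ge Pv); first exact: leO_refl.
by rewrite (val_opp Pv).
Qed.

Lemma lin_dist P b c : inV vbar P -> ltO (lin P b) (lin P c) ->
  omap (vemb P) (vbar (c - b)) = lin P b.
Proof.
by move=> [Pv _ _ PC] h; rewrite -PC const_shift (valD_lt Pv) // (val_opp Pv).
Qed.

Lemma omega_qcut_of_max P c0 : inV vbar P -> (forall c, leO (lin P c) (lin P c0)) ->
  exists dl : @qcut G, forall Q, inV vbar Q -> is_omega_qcut vbar c0 dl Q -> Veq Q P.
Proof.
move=> PV hmax; case: (PV) => [Pv PD Ple PC].
have [x ex] : exists x, lin P c0 = Some x.
  by apply: (val_neq0 Pv); rewrite tofrac_eq0 polyXsubC_eq0.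
(* The quasi-cut that [x] induces on [G], principal exactly when [x] is in the image of [G]. *)
pose dl := @QCut G (fun g => vemb P g <=z x) (fun g => x <=z vemb P g)
  (fun l r hl hr => etrans (esym (Ple l r)) (oz_trans hl hr))
  (fun g => orP (oz_total _ _)).
have hx : realizes (vemb P) dl x.
  by split=> // cut g e; apply: (cut g); rewrite /= e oz_refl.
exists dl => Q QV Qom; have [y hy linQ] := omega_qcut_lin QV Qom.
apply: (Veq_of_omega_lin QV PV hy hx linQ) => c; rewrite -ex.
apply: leO_eq; first by rewrite leO_min hmax lin_near.
have e : ('X - c%:P)%:F = ('X - c0%:P)%:F + ((c0 - c)%:P)%:F :> KX.
  by rewrite const_shift [RHS]addrC subrK.
by rewrite [lin P c]/lin e; apply: (valD_ge Pv); rewrite minO_le ?PC leO_refl ?orbT.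
Qed.

Lemma omega_nest_of_no_max P : inV vbar P ->
  (forall c, exists c', ltO (lin P c) (lin P c')) ->
  exists N : nest vbar, forall Q, inV vbar Q -> is_omega_nest N Q -> Veq Q P.
Proof.
move=> PV nomax; case: (PV) => [Pv PD Ple PC].
have linG c : exists g, lin P c = Some (vemb P g).
  (* A point with a larger value makes [lin P c] equal to a distance in [L], hence an element of
     [G]. *)
  have [c' h] := nomax c; have := lin_dist PV h.
  by case: (vbar _) => [g|] e; [exists g | rewrite -e in h].
pose mem c g := lin P c = Some (vemb P g).
have nested a g b e : mem a g -> mem b e -> g <=z e ->
    forall c, cball vbar b e c -> cball vbar a g c.
  move=> ha hb ge; apply/cball_sub; split=> //.
  rewrite /cball -(leO_emb Ple) -[omap _ (Some g)]ha; apply: lin_near => //.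
  by rewrite ha hb /= Ple.
have chain a g b e : mem a g -> mem b e ->
    (forall c, cball vbar a g c -> cball vbar b e c) \/
    (forall c, cball vbar b e c -> cball vbar a g c).
  by move=> ha hb; case/orP: (oz_total g e) => h; [right | left]; exact: nested h.
have empty c : exists a g, mem a g /\ ~ cball vbar a g c.
  (* The distance from [c'] to [c] is [lin P c], below the radius [lin P c'], so the ball around
     [c'] misses [c]. *)
  have [c' h] := nomax c; have [g eg] := linG c'; exists c', g; split=> //.
  rewrite /cball -(leO_emb Ple) (valBC hvbar) (lin_dist PV h) -[omap _ _]eg.
  by apply/negP; rewrite -ltONge.
exists (Nest chain empty) => Q QV Qom; apply: (Veq_of_finite_lin QV PV) => c.
have [a [g [Na far]]] := nest_avoid (Nest chain empty) c.
rewrite (omega_nest_lin QV Qom Na far).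
have h : ltO (lin P c) (lin P a).
  rewrite ltONge; apply/negP => /(lin_near PV); rewrite Na => h.
  by move: far; rewrite ltONge -(leO_emb Ple) (valBC hvbar) h.
rewrite -(lin_dist PV h); case: (vbar _) far => // z _.
by exists z.
Qed.

(** * Assembling the isomorphism *)

Definition specifies (b : Bel vbar) P :=
  match b with BQ a dl => is_omega_qcut vbar a dl P | BN N => is_omega_nest N P end.

Lemma specifies_exists b : exists P, inV vbar P /\ specifies b P.
Proof. by case: b => [a dl|N]; [exact: omega_qcut_exists | exact: omega_nest_exists]. Qed.

(** Quantifying over all [Q] specified by [b] makes this applicable to whichever package choice
    selects. *)
Lemma specifies_surj P : inV vbar P ->
  exists b, forall Q, inV vbar Q -> specifies b Q -> Veq Q P.
Proof.
move=> PV; have [[c hc]|nomax] := pselect (exists c, forall c', leO (lin P c') (lin P c)).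
  by have [dl h] := omega_qcut_of_max PV hc; exists (BQ c dl).
have [c|N h] := omega_nest_of_no_max PV; last by exists (BN N).
have /existsNP[c' h] : ~ forall c', leO (lin P c') (lin P c) by move=> h; apply: nomax; exists c.
by exists c'; rewrite ltONge; apply/negP.
Qed.

Lemma Veq_sym P Q : Veq P Q -> Veq Q P.
Proof. by move=> h u; rewrite h. Qed.

Section Order.
Variables (b b' : Bel vbar) (P Q : @vpkg L G).
Hypotheses (PV : inV vbar P) (QV : inV vbar Q) (bP : specifies b P) (bQ : specifies b' Q).

Lemma Ble_Vle : Ble b b' <-> Vle P Q.
Proof.
move: b b' bP bQ => [a dl|N] [a' dl'|M] /= Pom Qom.
- by split; [exact: Ble_qcut_Vle | exact: Vle_qcut_Ble].
- by split; [exact: Ble_qcut_nest_Vle | exact: Vle_Ble_qcut_nest].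
- by split=> // /(nest_not_le_qcut PV QV Pom Qom).
- by split=> [/(nest_equiv_Veq PV QV Pom Qom)|]; [left | exact: Vle_nest_equiv].
Qed.

End Order.

Lemma Beq_Ble (b b' : Bel vbar) : Beq b b' <-> Ble b b' /\ Ble b' b.
Proof.
case: b b' => [a dl|N] [a' dl'|M] /=; last by split=> [[]|[]].
- split=> [[eb [eL eR]]|[[s1 [l1 r1]] [s2 [l2 r2]]]].
    by split; (split=> [c /eb|] //; split=> g; [move/eL | move/eR]).
  split=> [c|]; first by split; [exact: s2 | exact: s1].
  by split=> g; split; auto.
- by split=> // -[].
- by split=> // -[].
Qed.

Lemma Beq_Veq (b b' : Bel vbar) P Q : inV vbar P -> inV vbar Q -> specifies b P -> specifies b' Q ->
  Beq b b' <-> Veq P Q.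
Proof.
move=> PV QV bP bQ; split; last first.
  move=> e; apply/Beq_Ble; split.
    by apply/(Ble_Vle PV QV bP bQ); left.
  by apply/(Ble_Vle QV PV bQ bP); left; exact: Veq_sym.
by move: b b' bP bQ => [a dl|N] [a' dl'|M] //=; [exact: Beq_qcut_Veq | exact: nest_equiv_Veq].
Qed.

End Extensions.

Theorem theorem2p10
  (K : fieldType) (L : closedFieldType) (iota : {rmorphism K -> L})
  (L_alg : forall y : L, exists p : {poly K}, p != 0 /\ root (map_poly iota p) y)
  (G : oZmodType) (v : K -> option G) (vbar : L -> option G)
  (hv : is_val v) (hvbar : is_val vbar)
  (hext : forall c : K, vbar (iota c) = v c)
  (hG : forall g : G, exists c : L, vbar c = Some g) :
  exists Phi : Bel vbar -> @vpkg L G,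
    (forall b, inV vbar (Phi b)) /\
        (forall a dl, is_omega_qcut vbar a dl (Phi (BQ a dl))) /\
        (forall N, is_omega_nest N (Phi (BN N))) /\
        (forall b b', Beq b b' <-> Veq (Phi b) (Phi b')) /\
        (forall P, inV vbar P -> exists b, Veq (Phi b) P) /\
        (forall b b', Ble b b' <-> Vle (Phi b) (Phi b')).
Proof.
have [Phi hPhi] := choice (specifies_exists hvbar hG); exists Phi.
have PhiV b := (hPhi b).1; have PhiS b := (hPhi b).2.
split=> //; split=> [a dl|]; first exact: (PhiS (BQ a dl)).
split=> [N|]; first exact: (PhiS (BN N)).
split=> [b b'|]; first exact: Beq_Veq.
split=> [P PV|b b']; last exact: Ble_Vle.
by have [b h] := specifies_surj hvbar hG PV; exists b; exact: h.
Qed.
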